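(* Let $d,m,r\in\mathbb{N}$. If $r\le 15$ and $d\ge 3m$, then the linear system $L_{3,d}(m^r)$ of degree $d$ surfaces in $\mathbb{P}^3$ having multiplicity at least $m$ at $r$ general points is non-special. In particular, the Laface-Ugaglia conjecture holds for these values of $d$, $m$ and $r$.
   Context: We work over $\mathbb{C}$. For general points $p_1,\dots,p_r\in\mathbb{P}^n$ and multiplicities $m_1,\dots,m_r$, $L_{n,d}(m_1,\dots,m_r)\subset H^0\mathcal{O}_{\mathbb{P}^n}(d)$ is the vector space of degree $d$ forms vanishing with multiplicity at least $m_i$ at $p_i$ for every $i$; $m^r$ means that the multiplicity $m$ is repeated $r$ times. Dimensions are those of vector spaces (affine dimensions). The virtual dimension is $$\operatorname{vdim} L_{n,d}(m_1,\dots,m_r)=\binom{n+d}{n}-\sum_{i=1}^r\binom{m_i-1+n}{n},$$ and the expected dimension is $\max\{\operatorname{vdim} L_{n,d}(m_1,\dots,m_r),0\}$. The system is non-special if its dimension equals its expected dimension, and special otherwise. When all multiplicities are equal, the Laface-Ugaglia conjecture predicts that $L_{3,d}(m^r)$ is non-special whenever $(d+1)^2>9\binom{m+1}{2}$ and $d\ge 2m-1$. *)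

(* Defs.v *)
From HB Require Import structures.
From mathcomp Require Import all_boot all_order all_algebra.
From mathcomp Require Import reals complex mpoly.

Set Implicit Arguments.
Unset Strict Implicit.
Unset Printing Implicit Defensive.

Import Order.TTheory GRing.Theory Num.Theory.
Local Open Scope ring_scope.

(* The field of complex numbers is R[i] for R : realType.
   An r-tuple of points of P^n is given by a matrix p : 'M_(r, n.+1) with nonzero
   rows, row i p holding homogeneous coordinates of the i-th point. *)

(* Multiplicity at least k at the point of P^n with homogeneous coordinates v: all
   partial derivatives of order < k vanish at v. For a form f <> 0 this does not
   depend on v, and (by Euler's relation) it amounts to the local equation of f
   in an affine chart having only terms of degree >= k at the point. *)
Definition mult_ge (R : realType) (N : nat) (k : nat)
    (v : 'I_N -> R[i]) (f : {mpoly R[i][N]}) : Prop :=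
  forall a : 'X_{1..N}, (mdeg a < k)%N -> (mderivm a f).@[v] = 0.

Definition deriv_at (R : realType) (N d : nat) (v : 'I_N -> R[i])
    (a : 'X_{1..N}) (f : dhomog N R[i] d) : R[i]^o :=
  (mderivm a f).@[v].

Fact deriv_at_is_linear (R : realType) (N d : nat) (v : 'I_N -> R[i])
  (a : 'X_{1..N}) : linear (@deriv_at R N d v a).
Proof.
by move=> c f g; rewrite /deriv_at linearP /= mevalD mevalZ.
Qed.

HB.instance Definition _ (R : realType) (N d : nat) (v : 'I_N -> R[i])
    (a : 'X_{1..N}) :=
  GRing.isLinear.Build R[i] (dhomog N R[i] d) (R[i]^o) _ (@deriv_at R N d v a)
    (@deriv_at_is_linear R N d v a).

(* L_{n,d}(m_1,...,m_r) for the points p; see mem_linear_system. *)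
Definition linear_system (R : realType) (n d r : nat) (m : 'I_r -> nat)
    (p : 'M[R[i]]_(r, n.+1)) : {vspace dhomog n.+1 R[i] d} :=
  (\bigcap_(i < r) \bigcap_(a : 'X_{1..n.+1 < m i})
     lker (linfun (@deriv_at R n.+1 d (p i) a)))%VS.

Lemma mem_linear_system (R : realType) (n d r : nat) (m : 'I_r -> nat)
    (p : 'M[R[i]]_(r, n.+1)) (f : dhomog n.+1 R[i] d) :
  f \in linear_system d m p <-> forall i, mult_ge (m i) (p i) f.
Proof.
rewrite /linear_system memvE; split=> [/subv_bigcapP fL i a lt_a | fL].
  have /subv_bigcapP/(_ (BMultinom lt_a) isT) := fL i isT.
  by rewrite -memvE memv_ker lfunE => /eqP.
apply/subv_bigcapP => i _; apply/subv_bigcapP => a _.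
by rewrite -memvE memv_ker lfunE; apply/eqP/fL/bmdeg.
Qed.

(* The variable of index mxvec_index i j is the j-th homogeneous coordinate on the
   i-th factor of (P^n)^r. *)
Definition multihomogeneous (R : realType) (n r : nat)
    (F : {mpoly R[i][r * n.+1]}) : Prop :=
  exists e : 'I_r -> nat, forall a, a \in msupp F ->
    forall i, (\sum_(j < n.+1) a (mxvec_index i j))%N = e i.

(* P holds for r general points of P^n: it holds on a nonempty Zariski open subset
   of (P^n)^r, which can be shrunk to the complement of the zero locus of a single
   nonzero multihomogeneous F. P is meant to be invariant under rescaling of the
   rows. *)
Definition for_general_points (R : realType) (n r : nat)
    (P : 'M[R[i]]_(r, n.+1) -> Prop) : Prop :=
  exists F : {mpoly R[i][r * n.+1]},
    [/\ F != 0, multihomogeneous F &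
        forall p : 'M[R[i]]_(r, n.+1), (forall i, row i p != 0) ->
          F.@[mxvec p 0] != 0 -> P p].

(* The binomial is written 'C(m i + n - 1, n) rather than 'C(m i - 1 + n, n), so
   that truncated subtraction gives 0 conditions when m i = 0 and n > 0. *)
Definition vdim (n d r : nat) (m : 'I_r -> nat) : int :=
  'C(n + d, n)%:Z - \sum_(i < r) 'C(m i + n - 1, n)%:Z.

Definition expdim (n d r : nat) (m : 'I_r -> nat) : int :=
  Num.max (vdim n d m) 0.

Definition nonspecial (R : realType) (n d r : nat) (m : 'I_r -> nat) : Prop :=
  for_general_points (fun p : 'M[R[i]]_(r, n.+1) =>
    (\dim (linear_system d m p))%:Z = expdim n d m).

(* The homogeneous Laface-Ugaglia conjecture for one triple (d, m, r). *)
Definition laface_ugaglia (R : realType) (d m r : nat) : Prop :=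
  (9 * 'C(m.+1, 2) < d.+1 ^ 2)%N -> (2 * m - 1 <= d)%N ->
  nonspecial R 3 d (fun _ : 'I_r => m).

(* Main.v *)
Require Import Defs.
From HB Require Import structures.
From mathcomp Require Import all_boot all_order all_algebra.
From mathcomp Require Import reals complex mpoly.
From mathcomp Require Import zify ring.

(** For these values the virtual dimension is nonnegative, and the theorem says
    that the vanishing conditions at general points are linearly independent on
    the forms of degree [d].  This is an open condition, so it suffices to find
    points, possibly over an extension of the base field, at which it holds.

    A toric degeneration provides them.  Over the field of rational functions in
    [t], take the points p_i = (1 : t ^ w_i1 : ... : t ^ w_in).  The derivative of
    order [a] of the monomial of exponent [b] at p_i is a power of [t] times the
    product of falling factorials [falling a b], a polynomial in [b] of degree
    [mdeg a].  A relation between the conditions is therefore, after rescaling,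
      sum_i t ^ (height_i b) * (sum_a c_ia * falling a b) = 0   for all b,
    where height_i is an affine function of [b].  Comparing leading coefficients in
    [t] at the exponents [b] where height_i dominates all the others shows that the
    leading part of (c_ia)_a is a polynomial of degree less than [m] vanishing on
    the [i]-th cell of the subdivision defined by the heights
    (lemma [tropical_independence]).  Everything reduces to a subdivision of the
    lattice tetrahedron of size [3 m] into fifteen cells, each of which is a
    uniqueness set for polynomials of degree less than [m].

    The planes parallel to the faces cut a tetrahedron of size 3 into ten
    tetrahedra, four octahedra and one reflected tetrahedron: exactly fifteen
    pieces, each containing a unit tetrahedron.  Scaled by [m] and slightly shifted,
    these pieces are the cells (lemma [cells_tropical]); that they are uniqueness
    sets is checked by slicing (lemma [staircase_pinned]).  The octahedra have
    no lattice points to themselves when [m = 1], and in that case Voronoi cells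
    of fifteen lattice points are used (lemma [voronoi_tropical]).

    On the geometric side, in the chart where the coordinate of index 0 is nonzero,
    Euler's relation reduces the vanishing of all derivatives of order less than
    [m] to those in the other coordinates (lemma [mult_ge_affine]); the linear system
    is then the kernel of a matrix, and a maximal minor of it, which is
    multihomogeneous in the points, defines the open set. *)

Set Implicit Arguments.
Unset Strict Implicit.
Unset Printing Implicit Defensive.

Import Order.TTheory GRing.Theory Num.Theory.
Local Open Scope ring_scope.

(** * Polynomial functions on lattice points *)

Section PolynomialFunctions.
Variable F : numFieldType.

(** [A k] stands for the functions on [X] of degree less than [k], so that the
    functions of several integer variables can be built one variable at a
    time.  The pointwise hypotheses in [filt0] and [filt_lin] make membership
    extensional without equating functions. *)
Record filtration (X : Type) (A : nat -> (X -> F) -> Prop) : Prop := Filtration {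
  filt0 : forall k f, (forall x, f x = 0) -> A k f;
  filt_lin : forall k c f g h, A k f -> A k g ->
    (forall x, h x = c * f x + g x) -> A k h;
  filtS : forall k f, A k f -> A k.+1 f }.

(** Polynomials of total degree less than [k] in one more variable [y], in Horner
    form [g + y h]: the coefficient [g] may use the whole degree, whereas [h]
    has one degree less. *)
Fixpoint add_var (X : Type) (A : nat -> (X -> F) -> Prop) (k : nat)
    (f : nat * X -> F) : Prop :=
  if k is k'.+1 then
    exists g h, [/\ A k g, add_var A k' h &
      forall y x, f (y, x) = g x + y%:R * h (y, x)]
  else forall z, f z = 0.

Lemma add_var_filtration X (A : nat -> (X -> F) -> Prop) :
  filtration A -> filtration (add_var A).
Proof.
move=> fA; split.
- elim=> [|k IHk] f f0 //=.
  exists (fun=> 0), (fun=> 0); split; [exact: (filt0 fA) | exact: IHk |].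
  by move=> y x; rewrite f0 mulr0 addr0.
- elim=> [|k IHk] c f g h /=.
    by move=> f0 g0 hE z; rewrite hE f0 g0 mulr0 addr0.
  move=> [f0 [f1 [Af0 Bf1 fE]]] [g0 [g1 [Ag0 Bg1 gE]]] hE.
  exists (fun x => c * f0 x + g0 x), (fun z => c * f1 z + g1 z); split.
  + exact: (filt_lin fA Af0 Ag0).
  + exact: IHk Bf1 Bg1 _.
  + by move=> y x; rewrite hE fE gE; ring.
- elim=> [|k IHk] f.
    move=> f0; exists (fun=> 0), (fun=> 0); split=> //; first exact: (filt0 fA).
    by move=> y x; rewrite f0 mulr0 addr0.
  move=> [f0 [f1 [Af0 /IHk Bf1 fE]]].
  by exists f0, f1; split=> //; apply: (filtS fA).
Qed.

Lemma filt_le X (A : nat -> (X -> F) -> Prop) k l f :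
  filtration A -> (k <= l)%N -> A k f -> A l f.
Proof.
move=> fA /subnKC <-; elim: (l - k)%N => [|j IHj] Akf; first by rewrite addn0.
by rewrite addnS; apply: (filtS fA); apply: IHj.
Qed.

Lemma filt_sum X (A : nat -> (X -> F) -> Prop) (I : finType) k
    (c : I -> F) (f : I -> X -> F) (h : X -> F) :
  filtration A -> (forall i, A k (f i)) ->
  (forall x, h x = \sum_i c i * f i x) -> A k h.
Proof.
move=> fA Af; elim: (index_enum I) h => [|i s IHs] h hE.
  by apply: (filt0 fA) => x; rewrite hE big_nil.
apply: (@filt_lin _ _ fA k (c i) (f i) (fun x => \sum_(j <- s) c j * f j x)) => //.
  exact: IHs.
by move=> x; rewrite hE big_cons.
Qed.

(** Induction on [a], through [y ^_ a.+1 = y ^_ a * (y - a)]: multiplying by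
    [y - a] raises the degree by one. *)
Lemma add_var_ffact X (A : nat -> (X -> F) -> Prop) k a g :
  filtration A -> (0 < k)%N -> A k g ->
  add_var A (k + a) (fun z => (z.1 ^_ a)%:R * g z.2).
Proof.
move=> fA k_gt0 Ag; elim: a => [|a IHa].
  rewrite addn0; case: k k_gt0 Ag => // k _ Ag.
  exists g, (fun=> 0); split=> //; first exact: (filt0 (add_var_filtration fA)).
  by move=> y x; rewrite mul1r mulr0 addr0.
have fB := add_var_filtration fA.
set f := (fun z => _) in IHa; rewrite addnS.
apply: (@filt_lin _ _ fB _ (- a%:R) f (fun z => z.1%:R * f z)).
- exact: (filtS fB).
- exists (fun=> 0), f; split=> //; first exact: (filt0 fA).
  by move=> y x; rewrite add0r.
move=> [y x]; rewrite /f /= ffactnSr.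
have [le_ay|lt_ya] := leqP a y; first by rewrite natrM natrB //; ring.
by rewrite ffact_small //; ring.
Qed.

(** Division by [y - y0], whose remainder is the restriction to the slice
    [y = y0]; the quotient loses one degree. *)
Lemma add_var_divide X (A : nat -> (X -> F) -> Prop) k f y0 :
  filtration A -> add_var A k.+1 f ->
  A k.+1 (fun x => f (y0, x)) /\
  exists2 h, add_var A k h &
    forall y x, f (y, x) = f (y0, x) + (y%:R - y0%:R) * h (y, x).
Proof.
move=> fA; have fB := add_var_filtration fA.
elim: k f => [|k IHk] f [g [f1 [Ag Bf1 fE]]].
  have fg y x : f (y, x) = g x by rewrite fE (Bf1 (y, x)) mulr0 addr0.
  split; last by exists (fun=> 0) => // y x; rewrite !fg mulr0 addr0.
  by apply: (filt_lin fA (c := 0) Ag Ag) => x; rewrite fg mul0r add0r.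
have [Af1 [h1 Bh1 f1E]] := IHk _ Bf1; split.
  by apply: (filt_lin fA (c := y0%:R) (filtS fA Af1) Ag) => x; rewrite fE addrC.
exists (fun z => f1 (y0, z.2) + z.1%:R * h1 z).
  by exists (fun x => f1 (y0, x)), h1.
by move=> y x; rewrite !fE (f1E y) /=; ring.
Qed.

(** [D] is a uniqueness set for the functions of degree less than [k]. *)
Definition pinned X (A : nat -> (X -> F) -> Prop) k (D : X -> Prop) :=
  forall f, A k f -> (forall x, D x -> f x = 0) -> forall x, f x = 0.

(** Slices are removed one at a time: a function vanishing on the slice
    [y = s 0] is divisible by [y - s 0], and the quotient, of one degree less,
    still vanishes on the other slices.  Hence the [j]-th slice only has to
    be a uniqueness set for degree less than [k - j]. *)
Lemma add_var_pinned X (A : nat -> (X -> F) -> Prop) k (s : nat -> nat)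
    (D : nat -> X -> Prop) :
  filtration A ->
  (forall i j, (i < k)%N -> (j < k)%N -> s i = s j -> i = j) ->
  (forall j, (j < k)%N -> pinned A (k - j) (D j)) ->
  pinned (add_var A) k (fun z => exists2 j, (j < k)%N & z.1 = s j /\ D j z.2).
Proof.
move=> fA; elim: k s D => [|k IHk] s D s_inj pD f Bf f0 //.
have [Af [h Bh fE]] := add_var_divide (s 0%N) fA Bf.
have fs0 x : f (s 0%N, x) = 0.
  by move: x; apply: (pD 0%N isT _ Af) => x Dx; apply: f0; exists 0%N.
suff h0 z : h z = 0 by case=> y x; rewrite fE fs0 h0 mulr0 addr0.
move: z; apply: (IHk (s \o S) (D \o S)) => //.
- move=> i j lt_ik lt_jk s_eq.
  by have [] := s_inj i.+1 j.+1 lt_ik lt_jk s_eq.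
- by move=> j lt_jk; rewrite -subSS; apply: pD.
move=> [y x] [j lt_jk [/= y_eq Dx]].
have := fE y x; rewrite fs0 add0r f0; last by exists j.+1.
move/esym/eqP; rewrite mulf_eq0 subr_eq0 eqr_nat => /orP[/eqP y_s0|/eqP //].
by have := s_inj j.+1 0%N lt_jk isT; rewrite -y_eq => /(_ y_s0).
Qed.

(** Polynomials in no variable: the degree bound [0] leaves only the zero
    constant, and a positive bound is no condition. *)
Definition const_fun k (f : unit -> F) := k = 0%N -> f tt = 0.

Lemma const_fun_filtration : filtration const_fun.
Proof.
split; first by move=> k f f0 _; apply: f0.
  by move=> k c f g h Hf Hg hE k0; rewrite hE Hf // Hg // mulr0 addr0.
by [].
Qed.

Definition polyfun3 := add_var (add_var (add_var const_fun)).

(** Three nested slicings.  The columns may be shifted and permuted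
    arbitrarily, which is what uniqueness sets inside octahedra require. *)
Lemma staircase_pinned k (s : nat -> nat) (t : nat -> nat -> nat)
    (u : nat -> nat -> nat -> nat) (f : nat * (nat * (nat * unit)) -> F) :
  (forall i j, (i < k)%N -> (j < k)%N -> s i = s j -> i = j) ->
  (forall x i j, (x + i < k)%N -> (x + j < k)%N -> t x i = t x j -> i = j) ->
  (forall x y i j, (x + y + i < k)%N -> (x + y + j < k)%N ->
     u x y i = u x y j -> i = j) ->
  polyfun3 k f ->
  (forall x y z, (x + y + z < k)%N -> f (s x, (t x y, (u x y z, tt))) = 0) ->
  forall b, f b = 0.
Proof.
move=> s_inj t_inj u_inj Pf f0.
have f1 := const_fun_filtration; have f2 := add_var_filtration f1.
pose D2 x y := fun z : nat * unit => exists2 j, (j < k - x - y)%N & z.1 = u x y j /\ True.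
pose D1 x := fun z : nat * (nat * unit) =>
  exists2 j, (j < k - x)%N & z.1 = t x j /\ D2 x j z.2.
apply: (@add_var_pinned _ _ k s D1 (add_var_filtration f2) s_inj _ f) => //.
  move=> x lt_xk; apply: (add_var_pinned f2).
    by move=> i j lt_i lt_j; apply: t_inj; lia.
  move=> y lt_y; apply: (@add_var_pinned _ _ _ _ (fun _ _ => True) f1).
    by move=> i j lt_i lt_j; apply: u_inj; lia.
  by move=> z lt_z g Ag g0 []; apply: g0.
move=> [? [? [? []]]] [x lt_x [/= -> [y lt_y [/= -> [z lt_z [/= -> _]]]]]].
by apply: f0; lia.
Qed.

End PolynomialFunctions.

(** * Uniqueness sets for falling factorials *)

Section FallingFactorials.

(** The coefficient of the derivative of order [a] of the monomial ['X_[b]]; as a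
    function of [b] it is a polynomial of degree [mdeg a]. *)
Definition falling n (a b : 'X_{1..n}) : nat := \prod_(k < n) (b k) ^_ (a k).

Lemma falling_neq0 n (a b : 'X_{1..n}) : falling a b != 0%N -> (a <= b)%MM.
Proof.
move=> fab; apply/mnm_lepP => k; rewrite leqNgt; apply: contra fab => lt_ba.
by rewrite /falling (bigD1 k) //= ffact_small.
Qed.

Lemma falling_gt0 n (a : 'X_{1..n}) : (0 < falling a a)%N.
Proof. by apply: prodn_gt0 => k; rewrite ffactnn fact_gt0. Qed.

(** The products of falling factorials of degree less than [m] remain linearly
    independent on the set [E] of exponents.  Dually, the monomials with
    exponents in [E] realize every jet of order less than [m] at the point (1,...,1). *)
Definition unisolvent (F : numFieldType) n m (E : 'X_{1..n} -> Prop) :=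
  forall c : 'X_{1..n < m} -> F,
    (forall b, E b -> \sum_a c a * (falling a b)%:R = 0) -> forall a, c a = 0.

(** The system is triangular: [falling a' a] vanishes unless [a' <= a]. *)
Lemma unisolvent_setT (F : numFieldType) n m :
  unisolvent F m (fun _ : 'X_{1..n} => True).
Proof.
move=> c c0 a; have [k] := ubnP (mdeg a); elim: k a => // k IHk a lt_a.
have := c0 a I; rewrite (bigD1 a) //= big1 ?addr0.
  move/eqP; rewrite mulf_eq0 pnatr_eq0 -[X in _ || X]negbK -lt0n falling_gt0 orbF.
  by move/eqP.
move=> a' ne_a'a; have [->|/falling_neq0 le_a'a] := eqVneq (falling a' a) 0%N.
  by rewrite mulr0.
rewrite IHk ?mul0r // -ltnS; apply: leq_trans lt_a; rewrite ltnS.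
rewrite -(submK le_a'a) mdegD -[X in (X < _)%N]add0n ltn_add2r lt0n mdeg_eq0.
apply: contra ne_a'a => /eqP aB0.
by apply/eqP/val_inj; rewrite /= -(submK le_a'a) aB0 add0m.
Qed.

Definition mk3 (x y z : nat) : 'X_{1..3} := [multinom [tuple x; y; z]].

Lemma mk3K (b : 'X_{1..3}) : mk3 (b ord0) (b 1%R) (b 2%R) = b.
Proof.
apply/mnmP => i; rewrite mnm_tnth /tnth.
by case: i => [[|[|[|]]]] //= ?; congr (b _); apply: val_inj.
Qed.

Lemma fallingE3 (a : 'X_{1..3}) x y z :
  falling a (mk3 x y z) = (x ^_ (a ord0) * (y ^_ (a 1%R) * (z ^_ (a 2%R))))%N.
Proof.
rewrite /falling !big_ord_recl big_ord0 muln1; congr (_ * (_ * _))%N.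
  by congr (_ ^_ (a _)); apply: val_inj.
by congr (_ ^_ (a _)); apply: val_inj.
Qed.

Lemma mdeg_mk3 x y z : mdeg (mk3 x y z) = (x + y + z)%N.
Proof. by rewrite mdegE !big_ord_recl big_ord0 addn0 addnA. Qed.

Lemma staircase_unisolvent (F : numFieldType) m (s : nat -> nat)
    (t : nat -> nat -> nat) (u : nat -> nat -> nat -> nat) :
  (forall i j, (i < m)%N -> (j < m)%N -> s i = s j -> i = j) ->
  (forall x i j, (x + i < m)%N -> (x + j < m)%N -> t x i = t x j -> i = j) ->
  (forall x y i j, (x + y + i < m)%N -> (x + y + j < m)%N ->
     u x y i = u x y j -> i = j) ->
  unisolvent F m (fun b => exists x y z,
    (x + y + z < m)%N /\ b = mk3 (s x) (t x y) (u x y z)).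
Proof.
move=> s_inj t_inj u_inj c c0; apply: unisolvent_setT => b _.
pose f (v : nat * (nat * (nat * unit))) : F :=
  \sum_a c a * (falling a (mk3 v.1 v.2.1 v.2.2.1))%:R.
suff: f (b ord0, (b 1%R, (b 2%R, tt))) = 0 by rewrite /f /= mk3K.
move: (_, _); apply: (staircase_pinned s_inj t_inj u_inj) => [|x y z lt_xyz].
  have f1 := const_fun_filtration F; have f2 := add_var_filtration f1.
  have f3 := add_var_filtration f2.
  apply: (filt_sum (add_var_filtration f3)
    (f := fun (a : 'X_{1..3 < m}) v => (v.1 ^_ (a ord0))%:R *
      ((v.2.1 ^_ (a 1%R))%:R * ((v.2.2.1 ^_ (a 2%R))%:R * 1)))) => [a|v]; last first.
    by apply: eq_bigr => a _; rewrite fallingE3 !natrM mulr1.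
  apply: (filt_le (k := 1 + a 2%R + a 1%R + a ord0) (add_var_filtration f3)).
    by have := bmdeg a; rewrite -[bmnm a]mk3K mdeg_mk3 !mk3K; lia.
  pose g1 (v : nat * unit) : F := (v.1 ^_ (a 2%R))%:R * 1.
  pose g2 (v : nat * (nat * unit)) : F := (v.1 ^_ (a 1%R))%:R * g1 v.2.
  apply: (add_var_ffact (g := g2) _ f3); first by rewrite addn_gt0.
  apply: (add_var_ffact (g := g1) _ f2) => //.
  exact: (add_var_ffact (g := fun=> 1) _ f1).
by apply: c0; exists x, y, z.
Qed.

End FallingFactorials.

(** * Fifteen cells of a subdivided tetrahedron *)

Section Subdivision.

Lemma unisolvent_sub (F : numFieldType) n m (E E' : 'X_{1..n} -> Prop) :
  (forall b, E b -> E' b) -> unisolvent F m E -> unisolvent F m E'.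
Proof. by move=> sEE' uE c c0; apply: uE => b /sEE'/c0. Qed.

Variant solid := Tetrahedron | Reflected | Octahedron.

(** Lattice points of the three kinds of cells, up to translation.  The reflected
    tetrahedron is a corner at (m, m, m) of the cube of edge [m], and the
    octahedron is what remains of the lattice cube of [m ^ 3] points once the
    corners at two opposite vertices are cut off. *)
Definition points (m : nat) (S : solid) (x y z : nat) : Prop :=
  match S with
  | Tetrahedron => (x + y + z < m)%N
  | Reflected => [/\ (x <= m)%N, (y <= m)%N, (z <= m)%N & (2 * m < x + y + z)%N]
  | Octahedron => [/\ (x < m)%N, (y < m)%N, (z < m)%N &
      (m <= x + y + z < 2 * m)%N]
  end.

Definition translate m S (o : nat * nat * nat) (b : 'X_{1..3}) : Prop :=
  exists x y z, points m S x y z /\ b = mk3 (o.1.1 + x) (o.1.2 + y) (o.2 + z).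

(** Each solid contains a staircase.  In the octahedron the slice [x = 0] is the
    poorest one, so the slices are taken in decreasing order of [x], and the
    slice reached at step [j] needs degree less than [m - j] only.  Within a
    slice the rows [y = 1, 2, ...] come first and the row [y = 0] last, for the
    same reason.  When [m = 1] the octahedron is empty. *)
Lemma solid_unisolvent (F : numFieldType) m S o :
  m != 1%N -> unisolvent F m (translate m S o).
Proof.
move=> m_neq1; case: S.
- apply: unisolvent_sub (@staircase_unisolvent F m (addn o.1.1)
    (fun _ => addn o.1.2) (fun _ _ => addn o.2) _ _ _);
      try by move=> *; lia.
  by move=> _ [x [y [z [lt_xyz ->]]]]; exists x, y, z.
- apply: unisolvent_sub (@staircase_unisolvent F m (fun x => o.1.1 + (m - x))%N
    (fun _ y => o.1.2 + (m - y))%N (fun _ _ z => o.2 + (m - z))%N _ _ _);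
      try by move=> *; lia.
  move=> _ [x [y [z [lt_xyz ->]]]]; exists (m - x)%N, (m - y)%N, (m - z)%N.
  by split=> //; split; lia.
- pose s x := (m.-1 - x)%N; pose t y := (y.+1 %% m)%N.
  have tE y : (y < m)%N -> t y = (if (y.+1 < m)%N then y.+1 else 0)%N.
    move=> lt_ym; rewrite /t; case: (ltnP y.+1 m) => [lt_y|ge_y].
      by rewrite modn_small.
    have -> : y.+1 = m by lia.
    by rewrite modnn.
  apply: unisolvent_sub (@staircase_unisolvent F m (fun x => o.1.1 + s x)%N
    (fun _ y => o.1.2 + t y)%N (fun x y z => o.2 + (m - s x - t y + z))%N _ _ _);
      try by move=> *; lia.
  + move=> _ [x [y [z [lt_xyz ->]]]]; exists (s x), (t y), (m - s x - t y + z)%N.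
    split=> //; rewrite /= (tE y); last lia.
    by rewrite /s; case: ifP => ?; split; lia.
  + by rewrite /s => *; lia.
  + move=> x i j lt_i lt_j; rewrite !tE; [|lia|lia].
    by case: ifP => ?; case: ifP => ?; lia.
Qed.

(** With [b0 = 3 m - b1 - b2 - b3], the entry (c0, c1, c2, c3, k, S, o) is the cell
    on which the affine function [4 (c0 b0 + c1 b1 + c2 b2 + c3 b3) - k] is
    maximal; [c] runs over the exponents of degree at most 2 in four
    variables.  The solid [S] translated by [o] is contained in that cell.  For
    [k] equal to 0, [4 m], [12 m] and [8 m] the walls would be the planes
    [bi = m] and [bi = 2 m], cutting the tetrahedron of size [3 m] into ten
    tetrahedra, four octahedra and a reflected tetrahedron of size [m], which share
    lattice points on the walls; the small additional constants assign to each
    cell enough of these points. *)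
Definition cells (m : nat) :
    seq (nat * nat * nat * nat * nat * solid * (nat * nat * nat)) :=
  [:: (0, 0, 0, 0, 0, Reflected, (0, 0, 0));
      (1, 0, 0, 0, 4 * m + 2, Octahedron, (0, 0, 0));
      (0, 1, 0, 0, 4 * m + 2, Octahedron, (m + 1, 0, 0));
      (0, 0, 1, 0, 4 * m + 2, Octahedron, (0, m + 1, 0));
      (0, 0, 0, 1, 4 * m + 2, Octahedron, (0, 0, m + 1));
      (2, 0, 0, 0, 12 * m + 4, Tetrahedron, (0, 0, 0));
      (0, 2, 0, 0, 12 * m + 4, Tetrahedron, (2 * m + 1, 0, 0));
      (0, 0, 2, 0, 12 * m + 4, Tetrahedron, (0, 2 * m + 1, 0));
      (0, 0, 0, 2, 12 * m + 4, Tetrahedron, (0, 0, 2 * m + 1));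
      (1, 1, 0, 0, 8 * m + 1, Tetrahedron, (m, 0, 0));
      (1, 0, 1, 0, 8 * m + 1, Tetrahedron, (0, m, 0));
      (1, 0, 0, 1, 8 * m + 1, Tetrahedron, (0, 0, m));
      (0, 1, 1, 0, 8 * m + 1, Tetrahedron, (m + 1, m, 0));
      (0, 1, 0, 1, 8 * m + 1, Tetrahedron, (m + 1, 0, m));
      (0, 0, 1, 1, 8 * m + 1, Tetrahedron, (0, m + 1, m))]%N.

Definition height n (w : 'X_{1..n}) (h : nat) (b : 'X_{1..n}) : nat :=
  (\sum_(k < n) w k * b k + h)%N.

Lemma height3 x y z h x' y' z' :
  height (mk3 x y z) h (mk3 x' y' z') = (x * x' + y * y' + z * z' + h)%N.
Proof. by rewrite /height !big_ord_recl big_ord0 addn0 addnA. Qed.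

(** Regions on which one of [r] affine functions is strictly larger than the
    others, each one rich enough to realize the jets of order less than [m]. *)
Definition tropical_cells (F : numFieldType) n r m d
    (w : 'I_r -> 'X_{1..n}) (h : 'I_r -> nat) (E : 'I_r -> 'X_{1..n} -> Prop) : Prop :=
  [/\ forall i, unisolvent F m (E i),
      forall i b, E i b -> (mdeg b <= d)%N &
      forall i j b, j != i -> E i b ->
        (height (w j) (h j) b < height (w i) (h i) b)%N].

Lemma cells_tropical (F : numFieldType) m : m != 1%N ->
  exists (w : 'I_15 -> 'X_{1..3}) h E, tropical_cells F m (3 * m) w h E.
Proof.
move=> m_neq1.
pose cell i := nth (0, 0, 0, 0, 0, Reflected, (0, 0, 0))%N (cells m) i.
(* Eliminating [b0] from the affine function gives slopes [4 c_i - 4 c_0] and the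
   constant [12 m c_0 - k]; adding 8 to every slope and [12 m + 4] to every constant
   changes no comparison and keeps them nonnegative. *)
pose w i := let: (c0, c1, c2, c3, _, _, _) := cell i in
  mk3 (8 + 4 * c1 - 4 * c0) (8 + 4 * c2 - 4 * c0) (8 + 4 * c3 - 4 * c0).
pose h i := let: (c0, _, _, _, k, _, _) := cell i in
  (12 * m * c0 + (12 * m + 4 - k))%N.
pose E i := translate m (cell i).1.2 (cell i).2.
exists (fun i : 'I_15 => w i), (fun i : 'I_15 => h i), (fun i : 'I_15 => E i).
split.
- by move=> i; apply: solid_unisolvent.
- case=> i lt_i b; rewrite /E /cell /=.
  do 15![case: i lt_i => [_|i lt_i]; first by
    move=> [x [y [z [/= Hp ->]]]]; rewrite mdeg_mk3; move: Hp; try case; lia].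
  by [].
(* For each pair of cells the comparison of heights is linear arithmetic. *)
case=> i lt_i [j lt_j] b; rewrite -val_eqE /= /E.
do 15![case: i lt_i => [_|i lt_i]; first by
  move=> ne_ji [x [y [z [/= Hp ->]]]]; rewrite /w /h /cell;
  (first [move: Hp => [? ? ? ?] | move: Hp => ?]);
  do 15![case: j lt_j ne_ji => [_ ne_ji|j lt_j ne_ji]; first by
    [ | rewrite !height3; lia]]; by []].
by [].
Qed.

(** Any fifteen exponents of degree at most 3 would do. *)
Definition cubic_exponents : seq (nat * nat * nat) :=
  [:: (0, 0, 0); (1, 0, 0); (0, 1, 0); (0, 0, 1); (2, 0, 0); (0, 2, 0);
      (0, 0, 2); (1, 1, 0); (1, 0, 1); (0, 1, 1); (3, 0, 0); (0, 3, 0);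
      (0, 0, 3); (2, 1, 0); (1, 2, 0)]%N.

(** For [m = 1] each cell needs a single exponent, and the affine functions
    [2 p . b - |p| ^ 2] have as cells the Voronoi cells of the points [p]. *)
Lemma voronoi_tropical (F : numFieldType) :
  exists (w : 'I_15 -> 'X_{1..3}) h E, tropical_cells F 1 3 w h E.
Proof.
pose p i := nth (0, 0, 0)%N cubic_exponents i.
exists (fun i : 'I_15 => mk3 (2 * (p i).1.1) (2 * (p i).1.2) (2 * (p i).2)).
exists (fun i : 'I_15 => 9 - ((p i).1.1 ^ 2 + (p i).1.2 ^ 2 + (p i).2 ^ 2))%N.
exists (fun i b => b = mk3 (p i).1.1 (p i).1.2 (p i).2); split.
- move=> i; apply: unisolvent_sub (@staircase_unisolvent F 1 (fun=> (p i).1.1)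
    (fun _ _ => (p i).1.2) (fun _ _ _ => (p i).2) _ _ _); try by move=> *; lia.
  by move=> _ [x [y [z [_ ->]]]].
- by case=> i lt_i b ->; rewrite mdeg_mk3; do 15![case: i lt_i => [//|i lt_i]].
case=> i lt_i [j lt_j] b; rewrite -val_eqE /= => ne_ji ->; rewrite !height3.
do 15![case: i lt_i ne_ji => [|i] lt_i ne_ji; first by
  do 15![case: j lt_j ne_ji => [_ /= ne_ji|j lt_j ne_ji]; first by []]; by []].
by [].
Qed.

Lemma tropical_cells_exist (F : numFieldType) m :
  exists (w : 'I_15 -> 'X_{1..3}) h E, tropical_cells F m (3 * m) w h E.
Proof.
have [->|/cells_tropical //] := eqVneq m 1%N.
exact: voronoi_tropical.
Qed.

End Subdivision.

(** * Leading coefficients along the cells *)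

(** Let [c i0 a0] have maximal size among the coefficients.  For [b] in the cell
    of [i0] the coefficient of degree [height (w i0) (h i0) b] plus the degree of
    [c i0 a0] comes from the terms of index [i0] alone, so the coefficients of
    that degree in the [c i0 a] satisfy a relation over [F] on [E i0], and vanish
    by unisolvence. *)
Lemma tropical_independence (F : numFieldType) (n r m d : nat)
    (w : 'I_r -> 'X_{1..n}) h E (c : 'I_r -> 'X_{1..n < m} -> {poly F}) :
  tropical_cells F m d w h E ->
  (forall b, (mdeg b <= d)%N ->
    \sum_i 'X^(height (w i) (h i) b) * \sum_a c i a * (falling a b)%:R = 0) ->
  forall i a, c i a = 0.
Proof.
move=> [uE dE sepE] c0 i1 a1.
pose P (ia : 'I_r * 'X_{1..n < m}) := size (c ia.1 ia.2).
have [[i0 a0] _ max_c] := @arg_maxnP _ (i1, a1) xpredT P isT.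
suff c00 : c i0 a0 = 0.
  apply/eqP; rewrite -size_poly_leq0 -(size_poly0 F) -c00.
  exact: (max_c (i1, a1)).
set N := (size (c i0 a0)).-1.
apply/eqP; rewrite -lead_coef_eq0 lead_coefE -/N; apply/eqP.
apply: (uE i0 (fun a => (c i0 a)`_N)) => b Eb.
have := congr1 (fun p : {poly F} => p`_(height (w i0) (h i0) b + N))
  (c0 b (dE _ _ Eb)).
rewrite coef0 coef_sum (bigD1 i0) //= [X in _ + X]big1 => [|i ne_i].
  rewrite addr0 coefXnM ltnNge leq_addr /= addKn coef_sum => coef_eq.
  rewrite -[RHS]coef_eq.
  by apply: eq_bigr => a _; rewrite [in RHS]mulr_natr coefMn mulr_natr.
rewrite coefXnM; case: ltnP => // le_h; rewrite coef_sum big1 // => a _.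
rewrite mulr_natr coefMn nth_default ?mul0rn //.
have /= := max_c (i, a) isT; rewrite /P /= => /leq_trans; apply.
by have := sepE _ _ _ ne_i Eb; rewrite /N; case: (size _) => [|k] //=; lia.
Qed.

(** * Nonzero minors over an integral domain *)

Local Notation "x %:F" := (tofrac x).

Lemma clear_denominators (D : idomainType) l (v : 'rV[{fraction D}]_l) :
  exists2 e : D, e != 0 & exists v' : 'rV[D]_l, map_mx (@tofrac D) v' = e%:F *: v.
Proof.
pose den j : D := (repr (v 0 j)).2; pose num j : D := (repr (v 0 j)).1.
have den_neq0 j : den j != 0 by apply: denom_ratioP.
have vE j : v 0 j * (den j)%:F = (num j)%:F.
  rewrite /num; unlock tofrac; rewrite -[v 0 j in LHS]reprK -[LHS]FracField.pi_mul.
  apply/eqmodP/eqP; rewrite /= /FracField.mulf.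
  rewrite !numden_Ratio ?mulf_neq0 ?oner_eq0 //; try exact: denom_ratioP.
  by rewrite !mulr1 mulrC.
exists (\prod_j den j); first exact/prodf_neq0.
exists (\row_j (num j * \prod_(k | k != j) den k)).
apply/rowP => j; rewrite !mxE [in RHS](bigD1 j) //= !rmorphM /= -vE.
by rewrite -mulrA mulrC.
Qed.

(** Rank over the field of fractions: a relation between the rows there becomes one
    over [D] after clearing denominators. *)
Lemma nonzero_minor (D : idomainType) k l (A : 'M[D]_(k, l)) :
  (forall v : 'rV_k, v *m A = 0 -> v = 0) ->
  exists f : 'I_k -> 'I_l, \det (colsub f A) != 0.
Proof.
move=> A_inj; pose B := map_mx (@tofrac D) A.
have B_free : row_free B.
  apply: inj_row_free => v vB0.
  have [e e_neq0 [v' v'E]] := clear_denominators v.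
  have v'0 : v' = 0.
    have v'A0 : map_mx (@tofrac D) (v' *m A) = 0.
      by rewrite map_mxM v'E -/B -scalemxAl vB0 scaler0.
    apply: A_inj; apply/rowP => j; apply/eqP; rewrite [X in _ == X]mxE -tofrac_eq0.
    by move/rowP: v'A0 => /(_ j); rewrite [LHS]mxE [RHS]mxE => /eqP.
  move/eqP: v'E; rewrite v'0 map_mx0 eq_sym scaler_eq0 tofrac_eq0.
  by rewrite (negPf e_neq0) => /eqP.
have BT_full : row_full B^T by rewrite /row_full mxrank_tr.
exists (fullrankfun BT_full).
have := fullrowsub_unit BT_full; rewrite unitmxE unitfE -det_tr.
rewrite trmx_mxsub trmxK -map_mxsub det_map_mx.
by rewrite tofrac_eq0.
Qed.

(** * The matrix of the vanishing conditions *)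

Section ConditionMatrix.

(** A monomial in the affine coordinates of index at least 1, multiplied by the
    [e]-th power of the coordinate of index 0. *)
Definition cone n (e : nat) (b : 'X_{1..n}) : 'X_{1..n.+1} :=
  [multinom oapp b e (unlift ord0 k) | k < n.+1].

Lemma cone0 n e (b : 'X_{1..n}) : cone e b ord0 = e.
Proof. by rewrite mnmE unlift_none. Qed.

Lemma coneS n e (b : 'X_{1..n}) k : cone e b (lift ord0 k) = b k.
Proof. by rewrite mnmE liftK. Qed.

Lemma mdeg_cone n e (b : 'X_{1..n}) : mdeg (cone e b) = (e + mdeg b)%N.
Proof.
rewrite !mdegE big_ord_recl cone0; congr addn.
by apply: eq_bigr => k _; rewrite coneS.
Qed.

Lemma falling_cone n e (a b : 'X_{1..n}) :
  falling (cone 0 a) (cone e b) = falling a b.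
Proof.
rewrite /falling big_ord_recl !cone0 ffactn0 mul1n.
by apply: eq_bigr => k _; rewrite !coneS.
Qed.

(** The value at the [i]-th point of the derivative of order [a], in the
    coordinates of index at least 1, of the monomial of degree [d] that
    dehomogenizes to [b] (lemma [cond_entry_deriv]).  It is defined over any ring
    so that it makes sense for generic points and for points over a polynomial
    ring. *)
Definition cond_entry (S : comNzRingType) n r d (Q : 'M[S]_(r, n.+1))
    (i : 'I_r) (a b : 'X_{1..n}) : S :=
  (falling a b)%:R * \prod_k Q i k ^+ (cone (d - mdeg b) b - cone 0 a)%MM k.

Lemma cond_entry_deriv (R : realType) n r d (p : 'M[R[i]]_(r, n.+1)) i a b :
  cond_entry d p i a b = (mderivm (cone 0 a) 'X_[cone (d - mdeg b) b]).@[p i].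
Proof. by rewrite mderivmX mevalZ mevalX -/(falling _ _) falling_cone. Qed.

Definition cond_mx (S : comNzRingType) n r d m (Q : 'M[S]_(r, n.+1)) :
    'M[S]_(#|{: 'I_r * 'X_{1..n < m}}|, #|{: 'X_{1..n < d.+1}}|) :=
  \matrix_(x, y) cond_entry d Q (enum_val x : 'I_r * 'X_{1..n < m}).1
    (enum_val x : 'I_r * 'X_{1..n < m}).2 (enum_val y : 'X_{1..n < d.+1}).

Lemma map_cond_mx (S T : comNzRingType) (f : {rmorphism S -> T}) n r d m
    (Q : 'M[S]_(r, n.+1)) :
  map_mx f (cond_mx d m Q) = cond_mx d m (map_mx f Q).
Proof.
apply/matrixP => x y; rewrite !mxE rmorphM rmorph_nat rmorph_prod; congr (_ * _).
by apply: eq_bigr => k _; rewrite rmorphXn mxE.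
Qed.

(** At the points (1 : t ^ w1 : ... : t ^ wn) the entry in row [(i, a)] and column
    [b] is [falling a b] times [t] to the power [w i . (b - a)].  Multiplying the
    row by suitable powers of [t] turns the exponent into the height of [b],
    up to a common shift [H + W]. *)
Lemma cond_mx_tropical_free (F : numFieldType) n r m d
    (w : 'I_r -> 'X_{1..n}) h E (Q : 'M[{poly F}]_(r, n.+1)) :
  tropical_cells F m d w h E ->
  (forall i, Q i ord0 = 1) -> (forall i k, Q i (lift ord0 k) = 'X^(w i k)) ->
  forall v : 'rV_#|{: 'I_r * 'X_{1..n < m}}|, v *m cond_mx d m Q = 0 -> v = 0.
Proof.
move=> cellE Q0 QS v vQ0.
pose dot i (a : 'X_{1..n}) := (\sum_(k < n) w i k * a k)%N.
pose H := (\max_i h i)%N.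
pose W := (\max_(ia : 'I_r * 'X_{1..n < m}) dot ia.1 ia.2)%N.
pose c i (a : 'X_{1..n < m}) :=
  v 0 (enum_rank (i, a)) * 'X^(H - h i + (W - dot i a)).
suff c0 i a : c i a = 0.
  apply/rowP => x; rewrite mxE -(enum_valK x); case: (enum_val x) => i a.
  by move/eqP: (c0 i a); rewrite mulf_eq0 expf_eq0 polyX_eq0 andbF orbF => /eqP.
move: i a; apply: (tropical_independence cellE) => b le_bd.
have lt_bd : (mdeg b < d.+1)%N by [].
have := congr1
  (fun u : 'rV_ _ => 'X^(H + W) * u 0 (enum_rank (BMultinom lt_bd))) vQ0.
rewrite [in RHS]mxE mulr0 => vQb; rewrite -[RHS]vQb mxE.
rewrite (reindex _ (onW_bij _ (enum_rank_bij _))) /=.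
under eq_bigr => i _ do rewrite mulr_sumr.
rewrite pair_bigA mulr_sumr; apply: eq_bigr => -[i a] _ /=.
rewrite mxE !enum_rankK /cond_entry /=.
have [->|/falling_neq0 le_ab] := eqVneq (falling a b) 0%N.
  by rewrite !(mul0r, mulr0).
rewrite big_ord_recl Q0 expr1n mul1r.
under eq_bigr => k _ do rewrite QS mnmBE !coneS -exprM.
rewrite -expr_sum /c.
have -> : (\sum_(k < n) w i k * (b k - a k) = dot i b - dot i a)%N.
  rewrite /dot -sumnB => [|k _]; first by apply: eq_bigr => k _; rewrite mulnBr.
  by rewrite leq_mul2l (mnm_lepP le_ab) orbT.
have le_dot : (dot i a <= dot i b)%N.
  by apply: leq_sum => k _; rewrite leq_mul2l (mnm_lepP le_ab) orbT.
have le_h : (h i <= H)%N by apply: leq_bigmax.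
have le_W : (dot i a <= W)%N by apply: (leq_bigmax (i, a)).
have regroup (p q s t u f : {poly F}) :
    p * q = s * t -> p * (u * q * f) = s * (u * (f * t)).
  by move=> pq; transitivity (p * q * (u * f)); [ring | rewrite pq; ring].
apply: regroup; rewrite -!exprD; congr ('X^_).
by rewrite /height -/(dot i b); lia.
Qed.

Definition generic_points (S : comNzRingType) n r :
    'M[{mpoly S[r * n.+1]}]_(r, n.+1) :=
  \matrix_(i, k) 'X_(mxvec_index i k).

Lemma map_generic_points (S T : comNzRingType) (f : {rmorphism S -> T}) n r
    (Q : 'M[T]_(r, n.+1)) :
  map_mx (mmap f (mxvec Q 0)) (generic_points S n r) = Q.
Proof. by apply/matrixP => i k; rewrite !mxE mmapX mmap1U mxvecE. Qed.

End ConditionMatrix.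

(** * A multihomogeneous minor *)

Section GenericMinor.

(** A minor of the generic matrix is nonzero as soon as it is so at one choice of
    points, even with coordinates in a larger ring. *)
Lemma generic_minor_neq0 (F : numFieldType) n r m d (w : 'I_r -> 'X_{1..n}) h E :
  tropical_cells F m d w h E ->
  exists f, \det (colsub f (cond_mx d m (generic_points F n r))) != 0.
Proof.
move=> cellE.
pose Q : 'M[{poly F}]_(r, n.+1) :=
  \matrix_(i, k) oapp (fun k' => 'X^(w i k')) 1 (unlift ord0 k).
have Q_inj : forall v : 'rV_#|{: 'I_r * 'X_{1..n < m}}|,
    v *m cond_mx d m Q = 0 -> v = 0.
  apply: (cond_mx_tropical_free cellE) => [i|i k].
    by rewrite mxE unlift_none.
  by rewrite mxE liftK.
have [f minor_neq0] := nonzero_minor Q_inj.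
exists f; apply: contraNneq minor_neq0 => gen0.
rewrite -(map_generic_points (@polyC F) Q) -map_cond_mx -map_mxsub det_map_mx gen0.
by rewrite rmorph0.
Qed.

(** Degree in the coordinates of the [i]-th point, declared as a measure on
    monomials in order to use the general theory of weighted homogeneity. *)
Definition multideg n r (i : 'I_r) (a : 'X_{1..r * n.+1}) : nat :=
  \sum_(k < n.+1) a (mxvec_index i k).

Fact multideg_0 n r (i : 'I_r) : multideg (n := n) i 0%MM = 0%N.
Proof. by apply: big1 => k _; rewrite mnm0E. Qed.

Fact multideg_D n r (i : 'I_r) :
  {morph multideg (n := n) i : a b / (a + b)%MM >-> (a + b)%N}.
Proof. by move=> a b; rewrite -big_split; apply: eq_bigr => k _; rewrite mnmDE. Qed.

HB.instance Definition _ n r (i : 'I_r) :=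
  isMeasure.Build (r * n.+1)%N (multideg (n := n) i)
    (@multideg_0 n r i) (@multideg_D n r i).

Lemma multideg_U n r (i j : 'I_r) (k : 'I_n.+1) :
  multideg j U_(mxvec_index i k)%MM = (i == j).
Proof.
rewrite /multideg (eq_bigr (fun k' => ((i == j) && (k == k') : nat))) =>
  [|k' _]; last first.
  rewrite mnm1E; congr nat_of_bool; apply/eqP/andP => [|[/eqP -> /eqP ->] //].
  move/(congr1 (mxvec (\matrix_(i0 < r, k0 < n.+1) (i0, k0)) 0)).
  by rewrite !mxvecE !mxE => -[-> ->].
case: eqP => _ /=; last by rewrite big1.
by rewrite (bigD1 k) //= eqxx big1 // => k' /negPf; rewrite eq_sym => ->.
Qed.

Lemma homog_prod_fin (F : fieldType) N (mf : measure N) (I : finType)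
    (e : I -> nat) (P : I -> {mpoly F[N]}) :
  (forall i, P i \is (e i).-homog for mf) ->
  \prod_i P i \is (\sum_i e i)%N.-homog for mf.
Proof.
move=> homP; elim/big_rec2: _ => [|i k p _]; first exact: dhomog1.
exact: dhomogM.
Qed.

Lemma cond_entry_homog (F : fieldType) n r d (i j : 'I_r) (a b : 'X_{1..n}) :
  (mdeg b <= d)%N ->
  cond_entry d (generic_points F n r) i a b
    \is ((i == j) * (d - mdeg a))%N.-homog for (multideg (n := n) j).
Proof.
move=> le_bd; rewrite /cond_entry.
have [->|/falling_neq0 le_ab] := eqVneq (falling a b) 0%N.
  by rewrite mul0r rpred0.
rewrite mulr_natl; apply: rpredMn.
suff -> : (d - mdeg a = \sum_k (cone (d - mdeg b) b - cone 0 a)%MM k)%N.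
  rewrite big_distrr /=; apply: homog_prod_fin => k; apply: dhomogMn.
  by rewrite mxE dhomogX /= multideg_U.
rewrite -mdegE.
have le_cone : (cone 0 a <= cone (d - mdeg b) b)%MM.
  apply/mnm_lepP => k; rewrite !mnmE; case: unliftP => //= k' _.
  exact: (mnm_lepP le_ab).
have := mdegD (cone (d - mdeg b) b - cone 0 a) (cone 0 a).
by rewrite submK // !mdeg_cone; lia.
Qed.

(** The degree of an entry of the matrix depends on its row only. *)
Lemma minor_homog (F : fieldType) n r d m (j : 'I_r) f :
  \det (colsub f (cond_mx d m (generic_points F n r)))
    \is (\sum_(x < #|{: 'I_r * 'X_{1..n < m}}|)
      ((enum_val x).1 == j) * (d - mdeg (enum_val x).2))%N.-homog
      for (multideg (n := n) j).
Proof.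
rewrite /determinant; apply: rpred_sum => s _; rewrite rpredMsign.
apply: homog_prod_fin => x; rewrite !mxE; apply: cond_entry_homog.
by rewrite -ltnS; apply: bmdeg.
Qed.

End GenericMinor.

(** * The linear system as the kernel of the condition matrix *)

Section Dimension.

Lemma euler (F : fieldType) N (e : nat) (g : {mpoly F[N]}) :
  (forall b, b \in msupp g -> mdeg b = e) ->
  \sum_k 'X_k * g^`M(k) = e%:R *: g.
Proof.
move=> g_homog; rewrite [in RHS](mpolyE g) scaler_sumr.
have dE k : 'X_k * g^`M(k) = \sum_(b <- msupp g) (b k)%:R *: (g@_b *: 'X_[b]).
  rewrite {1}(mpolyE g) raddf_sum mulr_sumr; apply: eq_bigr => b _ /=.
  rewrite mderivZ mderivX -!scalerAr scalerA mulrC -scalerA.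
  have [->|b_gt0] := posnP (b k); first by rewrite !scale0r.
  congr (_ *: (_ *: _)); rewrite -mpolyXD addmC submK //; apply/mnm_lepP => k'.
  by rewrite mnm1E; case: eqP => [<-|].
rewrite (eq_bigr _ (fun k _ => dE k)) exchange_big /= big_seq [in RHS]big_seq.
apply: eq_bigr => b /g_homog <-; rewrite mdegE natr_sum scaler_suml.
by apply: eq_bigr => k _.
Qed.

Variable R : realType.
Local Notation C := (R[i]).

Lemma deriv_homog N d (f : dhomog N C d) (a b : 'X_{1..N}) :
  b \in msupp (mderivm a f) -> mdeg b = (d - mdeg a)%N.
Proof.
rewrite mcoeff_msupp mcoeff_mderivm => fab.
have : (a + b)%MM \in msupp f.
  by rewrite mcoeff_msupp; apply: contraNneq fab => ->; rewrite mul0rn.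
have /dhomogP f_homog := dhomog_is_dhomog f.
by move/f_homog; rewrite /= mdegD => <-; rewrite addKn.
Qed.

(** Euler's relation for the derivatives of [f] expresses a derivative with respect
    to the coordinate of index 0, where the point does not vanish, by
    derivatives that involve that coordinate fewer times; hence an induction on
    [a ord0]. *)
Lemma mult_ge_affine n d m (v : 'I_n.+1 -> C) (f : dhomog n.+1 C d) :
  v ord0 != 0 ->
  (forall a : 'X_{1..n}, (mdeg a < m)%N -> (mderivm (cone 0 a) f).@[v] = 0) ->
  mult_ge m v f.
Proof.
move=> v0 f_aff a; move: {2}(a ord0) (erefl (a ord0)) => k.
elim: k a => [|k IHk] a a0 lt_a.
  have aE : a = cone 0 [multinom a (lift ord0 k) | k < n].
    apply/mnmP => k; case: (unliftP ord0 k) => [k' ->|->]; last by rewrite cone0.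
    by rewrite coneS mnmE.
  by rewrite aE f_aff //; move: lt_a; rewrite {1}aE mdeg_cone.
pose a' := (a - U_(ord0))%MM.
have aE : a = (a' + U_(ord0))%MM.
  rewrite submK //; apply/mnm_lepP => k'; rewrite mnm1E.
  by case: eqP => [<-|//]; rewrite a0.
have a'0 : a' ord0 = k by rewrite mnmBE mnm1E a0 subSS subn0.
have deg_a : mdeg a = (mdeg a').+1 by rewrite aE mdegD mdeg1 addn1.
have := congr1 (meval v) (euler (deriv_homog (f := f) (a := a'))).
rewrite raddf_sum mevalZ (IHk a') //; last by apply: ltnW; rewrite -deg_a.
rewrite mulr0 big_ord_recl /= big1 => [|j _]; last first.
  rewrite mevalM -mderivmU1m -mderivmDm IHk ?mulr0 //.
    by rewrite mnmDE mnm1E a'0 eq_sym (negPf (neq_lift _ _)) addn0.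
  by rewrite mdegD mdeg1 addn1 -deg_a.
rewrite addr0 mevalM mevalXU -mderivmU1m -mderivmDm -aE => /eqP.
by rewrite mulf_eq0 (negPf v0) => /eqP.
Qed.

Definition conditions n d r m (p : 'M[C]_(r, n.+1)) (f : dhomog n.+1 C d) :
    'rV[C]_#|{: 'I_r * 'X_{1..n < m}}| :=
  \row_x (mderivm (cone 0 (enum_val x : 'I_r * 'X_{1..n < m}).2) f).@[p
    (enum_val x : 'I_r * 'X_{1..n < m}).1].

Fact conditions_is_linear n d r m (p : 'M[C]_(r, n.+1)) :
  linear (@conditions n d r m p).
Proof.
by move=> c f g; apply/rowP => x; rewrite !mxE linearP /= mevalD mevalZ.
Qed.

HB.instance Definition _ n d r m (p : 'M[C]_(r, n.+1)) :=
  GRing.isLinear.Build C (dhomog n.+1 C d) _ _ (@conditions n d r m p)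
    (@conditions_is_linear n d r m p).

Lemma linear_system_lker n d r m (p : 'M[C]_(r, n.+1)) :
  (forall i, p i ord0 != 0) ->
  linear_system d (fun=> m) p = lker (linfun (@conditions n d r m p)).
Proof.
move=> p0; apply/vspaceP => f; rewrite memv_ker lfunE /=.
apply/idP/eqP => [/mem_linear_system fL|/rowP f0].
  apply/rowP => x; rewrite !mxE; apply: fL.
  by rewrite mdeg_cone; apply: bmdeg.
apply/mem_linear_system => i; apply: mult_ge_affine => // a lt_a.
by have := f0 (enum_rank (i, BMultinom lt_a)); rewrite !mxE enum_rankK.
Qed.

Lemma conditions_surj n d r m (p : 'M[C]_(r, n.+1)) :
  row_free (cond_mx d m p) ->
  limg (linfun (@conditions n d r m p)) = fullv.
Proof.
move=> cond_free; apply/eqP; rewrite eqEsubv subvf /=; apply/subvP => y _.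
have /submxP[u yE] : (y <= (cond_mx d m p)^T)%MS.
  by apply: submx_full; rewrite /row_full mxrank_tr.
pose g : {mpoly C[n.+1]} :=
  \sum_j u 0 j *: 'X_[cone (d - mdeg (enum_val j : 'X_{1..n < d.+1}))
    (enum_val j : 'X_{1..n < d.+1})].
have g_homog : g \is d.-homog.
  apply: rpred_sum => j _; apply: rpredZ; rewrite dhomogX /= mdeg_cone.
  by rewrite subnK // -ltnS; apply: bmdeg.
suff -> : y = linfun (@conditions n d r m p) (DHomog g_homog).
  by apply: memv_img; rewrite memvf.
rewrite lfunE /=; apply/rowP => x; rewrite yE !mxE /= !raddf_sum /=.
apply: eq_bigr => j _; rewrite mderivmZ mevalZ -cond_entry_deriv.
by rewrite !mxE.
Qed.

Lemma dim_linear_system n d r m (p : 'M[C]_(r, n.+1)) :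
  (forall i, p i ord0 != 0) -> row_free (cond_mx d m p) ->
  (\dim (linear_system d (fun=> m) p) + r * #|{: 'X_{1..n < m}}| = 'C(n + d, n))%N.
Proof.
move=> p0 cond_free; rewrite linear_system_lker //.
have dim_jets k : \dim {: 'rV[C]_k} = k by rewrite dimvf /dim /= mul1n.
have card_conditions : #|{: 'I_r * 'X_{1..n < m}}| = (r * #|{: 'X_{1..n < m}}|)%N.
  by rewrite card_prod card_ord.
have := limg_ker_dim (linfun (@conditions n d r m p)) fullv.
rewrite capfv conditions_surj // dim_jets -card_conditions => ->.
by rewrite dimvf [LHS]/dim /= addnC -bin_sub ?leq_addl // addnK.
Qed.

(** [cone] identifies the exponents of degree at most [k] in [n] variables with
    those of degree [k] in [n.+1] variables. *)
Lemma card_jets n m : (0 < n)%N -> #|{: 'X_{1..n < m}}| = 'C(m + n - 1, n).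
Proof.
move=> n_gt0; case: m => [|k].
  rewrite bin_small ?add0n ?subn1 ?prednK //.
  by apply: eq_card0 => a; have := bmdeg a.
rewrite addSn subn1 /= -(bin_sub (leq_addl k n)) addnK -size_basis.
pose L := [seq cone (k - mdeg (bmnm a)) a | a <- enum {: 'X_{1..n < k.+1}}].
have <- : size L = #|{: 'X_{1..n < k.+1}}| by rewrite size_map cardE.
apply: perm_size; apply: uniq_perm.
- rewrite map_inj_uniq ?enum_uniq // => a b /mnmP eq_ab; apply: val_inj.
  by apply/mnmP => i; have := eq_ab (lift ord0 i); rewrite !coneS.
- exact: uniq_basis.
move=> b; rewrite -basis_cover; apply/mapP/eqP => [[a _ ->]|deg_b].
  by rewrite mdeg_cone subnK // -ltnS bmdeg.
pose a := [multinom b (lift ord0 i) | i < n].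
have bE : b = cone (b ord0) a.
  apply/mnmP => i; case: (unliftP ord0 i) => [i' ->|->]; last by rewrite cone0.
  by rewrite coneS mnmE.
have deg_a : (mdeg a < k.+1)%N by rewrite -deg_b bE mdeg_cone ltnS leq_addl.
exists (BMultinom deg_a); first by rewrite mem_enum.
by rewrite /= {1}bE -deg_b {2}bE mdeg_cone addnK.
Qed.

(** The open set is the nonvanishing locus of a maximal minor, on which the
    conditions are independent, times the coordinates of index 0, so that all
    points lie in the affine chart where the conditions are written. *)
Lemma tropical_cells_nonspecial n d m r (w : 'I_r -> 'X_{1..n}) h E :
  (0 < n)%N -> tropical_cells C m d w h E ->
  nonspecial R n d (fun _ : 'I_r => m).
Proof.
move=> n_gt0 cellE; have [f minor_neq0] := generic_minor_neq0 cellE.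
pose P : {mpoly C[r * n.+1]} := \prod_(i < r) 'X_(mxvec_index i (ord0 : 'I_n.+1)).
exists (\det (colsub f (cond_mx d m (generic_points C n r))) * P); split.
- by rewrite mulf_neq0 //; apply/prodf_neq0 => i _; rewrite -msupp_eq0 msuppX.
- exists (fun i => (\sum_(x < #|{: 'I_r * 'X_{1..n < m}}|)
    ((enum_val x).1 == i) * (d - mdeg (enum_val x).2) + \sum_(j < r) (j == i))%N).
  move=> a a_supp i; apply/(dhomogP (multideg (n := n) i)) : a_supp.
  apply: dhomogM; first exact: minor_homog.
  by apply: homog_prod_fin => j; rewrite dhomogX /= multideg_U.
move=> p _; rewrite mevalM mulf_eq0 negb_or => /andP[det_neq0 P_neq0].
have p0 i : p i ord0 != 0.
  move: P_neq0; rewrite /P rmorph_prod /= => /prodf_neq0/(_ i isT).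
  by rewrite mevalXU mxvecE.
have cond_free : row_free (cond_mx d m p).
  have det_p : \det (colsub f (cond_mx d m p)) != 0.
    rewrite -(map_generic_points idfun p) -map_cond_mx -map_mxsub det_map_mx.
    exact: det_neq0.
  apply: inj_row_free => v vA0.
  have sub_unit : colsub f (cond_mx d m p) \in unitmx by rewrite unitmxE unitfE.
  rewrite -(mulmxK sub_unit v) mulmx_colsub vA0.
  suff -> : colsub f (0 : 'M[C]_(1, _)) = 0 by rewrite mul0mx.
  by apply/matrixP => x y; rewrite !mxE.
have := dim_linear_system p0 cond_free; rewrite card_jets // => dimE.
have vdimE : vdim n d (fun _ : 'I_r => m) = (\dim (linear_system d (fun=> m) p))%:Z.
  rewrite /vdim -dimE sumr_const card_ord PoszD PoszM.
  by rewrite -[_ *+ r]mulr_natl natz addrK.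
by rewrite /expdim vdimE; apply/esym/max_idPl.
Qed.

End Dimension.

(** Fewer points use some of the fifteen cells, and a degree larger than [3 m] only
    adds columns to the condition matrix. *)
Lemma nonspecial_fifteen (R : realType) d m r :
  (r <= 15)%N -> (3 * m <= d)%N -> nonspecial R 3 d (fun _ : 'I_r => m).
Proof.
move=> le_r15 le_md; have [w [h [E [uE dE sepE]]]] := tropical_cells_exist R[i] m.
pose j := widen_ord le_r15.
apply: (@tropical_cells_nonspecial R 3 d m r (w \o j) (h \o j) (E \o j)) => //.
split=> /=.
- by move=> i; apply: uE.
- by move=> i b Eb; apply: leq_trans (dE _ _ Eb) le_md.
- by move=> i i' b ne_i Eb; apply: sepE Eb; apply: contra ne_i => /eqP [] /val_inj ->.
Qed.

Theorem theorem1 (R : realType) (d m r : nat)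
    (hr : (r <= 15)%N) (hd : (3 * m <= d)%N) :
  nonspecial R 3 d (fun _ : 'I_r => m) /\ laface_ugaglia R d m r.
Proof.
by have nonsp := nonspecial_fifteen R hr hd; split=> // _ _.
Qed.
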